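(* Let (C) be the statement: for every positive integer $n$, if a system $\mathcal{S}\subseteq B_n$ has exactly one solution in positive integers $x_1,\ldots,x_n$, then $x_1,\ldots,x_n \leqslant g(2n)$ for this solution. Then (C) implies that every set $\mathcal{M} \subseteq \mathbb{N}$ which has a single-fold Diophantine representation is computable. In particular, (C) contradicts Matiyasevich's conjecture on single-fold Diophantine representations, i.e. (C) and that conjecture cannot both be true.
   Context: $\mathbb{N}$ denotes the non-negative integers. For a positive integer $n$, $B_n=\{x_i \cdot x_j=x_k,\ x_i+1=x_k : i,j,k \in \{1,\ldots,n\}\}$, a finite set of equations in the variables $x_1,\ldots,x_n$ (the indices need not be distinct). The function $g$ on positive integers is defined by $g(1)=1$ and $g(n+1)=2^{2^{g(n)}}$ for every positive integer $n$. A set $\mathcal{M}\subseteq \mathbb{N}^n$ has a single-fold Diophantine representation if there is a polynomial $W$ with integer coefficients such that for all $a_1,\ldots,a_n\in\mathbb{N}$: $(a_1,\ldots,a_n)\in\mathcal{M}$ if and only if there exist $x_1,\ldots,x_m\in\mathbb{N}$ with $W(a_1,\ldots,a_n,x_1,\ldots,x_m)=0$, and moreover for all $a_1,\ldots,a_n\in\mathbb{N}$ the equation $W(a_1,\ldots,a_n,x_1,\ldots,x_m)=0$ has at most one solution $(x_1,\ldots,x_m)\in\mathbb{N}^m$. Matiyasevich's conjecture on single-fold Diophantine representations states that every recursively enumerable set $\mathcal{M}\subseteq\mathbb{N}^n$ has a single-fold Diophantine representation. *)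

(* Defs.v *)
From HB Require Import structures.
From mathcomp Require Import all_boot all_order all_algebra.
From mathcomp Require Import mpoly.

Set Implicit Arguments.
Unset Strict Implicit.
Unset Printing Implicit Defensive.

Inductive equation (n : nat) : Type :=
  | MulEq (i j k : 'I_n) (* x_i * x_j = x_k *)
  | SuccEq (i k : 'I_n). (* x_i + 1 = x_k *)

Section EquationFinite.
Variable n : nat.

Definition equation_encode (e : equation n) :
    'I_n * 'I_n * 'I_n + 'I_n * 'I_n :=
  match e with
  | MulEq i j k => inl (i, j, k)
  | SuccEq i k => inr (i, k)
  end.

Definition equation_decode (c : 'I_n * 'I_n * 'I_n + 'I_n * 'I_n) :
    equation n :=
  match c with
  | inl (i, j, k) => MulEq i j k
  | inr (i, k) => SuccEq i k
  end.

Lemma equation_encodeK : cancel equation_encode equation_decode.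
Proof. by case. Qed.

HB.instance Definition _ := Finite.copy (equation n) (can_type equation_encodeK).
End EquationFinite.

Definition satisfies (n : nat) (x : n.-tuple nat) (e : equation n) : Prop :=
  match e with
  | MulEq i j k => tnth x i * tnth x j = tnth x k
  | SuccEq i k => tnth x i + 1 = tnth x k
  end.

(* B_n = {x_i * x_j = x_k, x_i + 1 = x_k : i, j, k} is the whole finite type
   [equation n], so a system S included in B_n is an S : {set equation n}. *)
Definition positive_solution (n : nat) (S : {set equation n})
    (x : n.-tuple nat) : Prop :=
  (forall i : 'I_n, 0 < tnth x i) /\
  (forall e : equation n, e \in S -> satisfies x e).

(* Only the values at n >= 1 are meaningful; g 0 is a junk value. *)
Definition g (n : nat) : nat := iter n.-1 (fun t => 2 ^ (2 ^ t)) 1.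

Lemma g1 : g 1 = 1.
Proof. by []. Qed.

Lemma gS (n : nat) : 0 < n -> g n.+1 = 2 ^ (2 ^ g n).
Proof. by case: n. Qed.

Definition statement_C : Prop :=
  forall n : nat, 0 < n ->
  forall (S : {set equation n}) (x : n.-tuple nat),
    unique (positive_solution S) x ->
    forall i : 'I_n, tnth x i <= g (2 * n).

Definition natset (n : nat) : Type := n.-tuple nat -> Prop.

Definition natset1 (M : nat -> Prop) : natset 1 := fun a => M (thead a).

Definition poly_eval (n m : nat) (W : {mpoly int[n + m]})
    (a : n.-tuple nat) (x : m.-tuple nat) : int :=
  W.@[fun i => (tnth [tuple of a ++ x] i)%:Z]%R.

Definition single_fold (n : nat) (M : natset n) : Prop :=
  exists (m : nat) (W : {mpoly int[n + m]}),
    (forall a : n.-tuple nat,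
       M a <-> exists x : m.-tuple nat, poly_eval W a x = 0%R) /\
    (forall (a : n.-tuple nat) (x y : m.-tuple nat),
       poly_eval W a x = 0%R -> poly_eval W a y = 0%R -> x = y).

(* Programs for the n-ary partial (mu-)recursive functions. *)
Inductive recfun : nat -> Type :=
  | RZero n : recfun n
  | RSucc : recfun 1
  | RProj n (i : 'I_n) : recfun n
  | RComp n k (f : recfun k) (h : 'I_k -> recfun n) : recfun n
  | RPrec n (f : recfun n) (h : recfun n.+2) : recfun n.+1
  | RMin n (f : recfun n.+1) : recfun n.

(* Graph of the function defined from the graphs F and H by
   p(0, v) = F(v) and p(k + 1, v) = H(k, p(k, v), v). *)
Fixpoint prec_graph (n : nat) (F : n.-tuple nat -> nat -> Prop)
    (H : n.+2.-tuple nat -> nat -> Prop) (v : n.-tuple nat)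
    (k y : nat) : Prop :=
  match k with
  | 0 => F v y
  | k'.+1 => exists z : nat,
      prec_graph F H v k' z /\ H [tuple of k' :: z :: v] y
  end.

(* [computes f v y]: the partial function denoted by f is defined at v, with
   value y.  Composition is strict, and minimization requires the function to
   be defined at all arguments below the least zero. *)
Fixpoint computes (n : nat) (f : recfun n) : n.-tuple nat -> nat -> Prop :=
  match f in recfun n return n.-tuple nat -> nat -> Prop with
  | RZero _ => fun _ y => y = 0
  | RSucc => fun v y => y = (thead v).+1
  | RProj _ i => fun v y => y = tnth v i
  | @RComp n k f h => fun v y => exists w : k.-tuple nat,
      (forall i : 'I_k, computes (h i) v (tnth w i)) /\ computes f w y
  | @RPrec n f h => fun v y =>
      prec_graph (computes f) (computes h) (behead_tuple v) (thead v) y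
  | @RMin n f => fun v y =>
      computes f [tuple of y :: v] 0 /\
      forall z : nat, z < y -> exists t : nat,
        computes f [tuple of z :: v] t.+1
  end.

(* The characteristic function of M is (total) recursive. *)
Definition computable (n : nat) (M : natset n) : Prop :=
  exists f : recfun n, forall a : n.-tuple nat,
    (M a -> computes f a 1) /\ (~ M a -> computes f a 0).

(* M is the domain of a partial recursive function. *)
Definition recursively_enumerable (n : nat) (M : natset n) : Prop :=
  exists f : recfun n, forall a : n.-tuple nat,
    M a <-> exists y : nat, computes f a y.

Definition Matiyasevich_single_fold_conjecture : Prop :=
  forall n : nat, 0 < n ->
  forall M : natset n, recursively_enumerable M -> single_fold M.

(* Main.v *)
Require Import Defs.
From mathcomp Require Import all_boot all_order all_algebra zify ring.
From mathcomp Require Import mpoly.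

Set Implicit Arguments.
Unset Strict Implicit.
Unset Printing Implicit Defensive.

(** Everything rests on one bound.  Let W(a, y_1, ..., y_q) be an integer
polynomial.  A value a is pinned by a chain of a successor equations starting
from 1, and the equation W(a, y) = 0 is split into elementary steps, so for
each a there is a subsystem of B_N, with N = c + a and c depending on W only,
whose positive solutions correspond bijectively to the natural solutions y of
W(a, y) = 0 ([pinned_system]).  The correspondence sends y_i to the variable
y_i + 1; subtraction is removed by moving negative terms to the other side
([poly_eval_eq0]), and x + y = z is expressed for positive integers by
Robinson's identity (zx + 1)(zy + 1) = z^2(xy + 1) + 1 ([addition_identity]).
All auxiliary variables are functions of the input variables, so uniqueness of
y gives uniqueness of the solution of the system.  Under (C), if y is the only
solution of W(a, y) = 0, then every y_i is less than g(2(c + a))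
([solution_bound]).

Computability: if W is a single-fold representation of M, then a is in M
exactly when W(a, x) = 0 has a solution with entries less than g(2(c + a)).
The bound is a recursive function of a, and a search below a recursive bound
is recursive ([recursive_bounded_search]).

Contradiction with the conjecture: the bound is g(2a) up to a shift of the
argument, so a recursive function that grows faster violates it.  The graph of
a |-> g(4a) is recursively enumerable; by the conjecture it has a single-fold
representation W(a, b, x).  For fixed a the pair (b, x) is the unique zero of W(a, ., .), so
the bound applies to the polynomial W with b regarded as an unknown and gives
g(4a) = b < g(2(c + a)).  For a = c this reads g(4c) < g(4c). *)

(** * Polynomial equations over the positive integers *)

(** Without a zero or a subtraction, every subterm has a positive value at
positive inputs, so each subterm can be a variable of a system over the
positive integers. *)
Inductive expr (q : nat) : Type :=
  | One
  | Var of 'I_q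
  | Next of expr q
  | Add of expr q & expr q
  | Mul of expr q & expr q.
Arguments One {q}.

Fixpoint eval q (x : nat -> nat) (e : expr q) : nat :=
  match e with
  | One => 1
  | Var i => x i
  | Next d => (eval x d).+1
  | Add d f => eval x d + eval x f
  | Mul d f => eval x d * eval x f
  end.

Lemma eq_eval q (x y : nat -> nat) (e : expr q) :
  (forall i : 'I_q, x i = y i) -> eval x e = eval y e.
Proof. by move=> xy; elim: e => //= [d ->|d -> f ->|d -> f ->]. Qed.

Lemma eval_gt0 q (x : nat -> nat) (e : expr q) :
  (forall i, 0 < x i) -> 0 < eval x e.
Proof.
by move=> x_gt0; elim: e => //= d Hd f Hf; rewrite ?muln_gt0 ?addn_gt0 Hd ?Hf.
Qed.

Definition numeral q a : expr q := iter a (@Next q) One.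

Lemma eval_numeral q x a : eval x (numeral q a) = a.+1.
Proof. by elim: a => //= a ->. Qed.

Section PolynomialEquations.
Import GRing.Theory.
Local Open Scope ring_scope.

(** The shift v |-> v + 1 carries natural unknowns to positive ones. *)
Definition shifted_difference k (f : (nat -> nat) -> int) :=
  exists P Q : expr k, forall v : nat -> nat,
    f v = (eval (fun j => (v j).+1) P)%:Z - (eval (fun j => (v j).+1) Q)%:Z.

Lemma shifted_difference_const k (c : int) :
  @shifted_difference k (fun=> c).
Proof.
case: c => n; [exists (numeral k n), One | exists One, (numeral k n.+1)] => v;
  rewrite eval_numeral /=; lia.
Qed.

Lemma shifted_differenceD k f g :
  @shifted_difference k f -> @shifted_difference k g ->
  @shifted_difference k (fun v => f v + g v).
Proof.
move=> [P [Q fE]] [R [S gE]]; exists (Add P R), (Add Q S) => v.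
by rewrite fE gE /= !PoszD; ring.
Qed.

Lemma shifted_differenceM k f g :
  @shifted_difference k f -> @shifted_difference k g ->
  @shifted_difference k (fun v => f v * g v).
Proof.
move=> [P [Q fE]] [R [S gE]].
exists (Add (Mul P R) (Mul Q S)), (Add (Mul P S) (Mul Q R)) => v.
by rewrite fE gE /= !PoszD !PoszM; ring.
Qed.

Lemma eq_shifted_difference k f g :
  f =1 g -> @shifted_difference k f -> @shifted_difference k g.
Proof. by move=> fg [P [Q fE]]; exists P, Q => v; rewrite -fg. Qed.

Lemma shifted_difference_meval k (W : {mpoly int[k]}) :
  @shifted_difference k (fun v => W.@[fun i => (v i)%:Z]).
Proof.
apply: (@eq_shifted_difference _ (fun v => \sum_(m <- msupp W)
    W@_m * \prod_(i <- enum 'I_k) (v i)%:Z ^+ m i)).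
  by move=> v; rewrite mevalE; apply: eq_bigr => m _; rewrite big_enum.
elim: (msupp W) => [|m s IHs].
  apply: eq_shifted_difference (shifted_difference_const k 0) => v.
  by rewrite big_nil.
apply: (@eq_shifted_difference _ (fun v =>
   W@_m * \prod_(i <- enum 'I_k) (v i)%:Z ^+ m i + \sum_(m <- s)
    W@_m * \prod_(i <- enum 'I_k) (v i)%:Z ^+ m i)).
  by move=> v; rewrite big_cons.
apply: shifted_differenceD (IHs); apply: shifted_differenceM.
  exact: shifted_difference_const.
elim: (enum 'I_k) => [|i t IHt].
  apply: eq_shifted_difference (shifted_difference_const k 1) => v.
  by rewrite big_nil.
apply: (@eq_shifted_difference _ (fun v =>
   (v i)%:Z ^+ m i * \prod_(i <- t) (v i)%:Z ^+ m i)).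
  by move=> v; rewrite big_cons.
apply: shifted_differenceM (IHt).
elim: (m i) => [|d IHd].
  by apply: eq_shifted_difference (shifted_difference_const k 1) => v.
apply: (@eq_shifted_difference _ (fun v => (v i)%:Z * (v i)%:Z ^+ d)).
  by move=> v; rewrite exprS.
apply: shifted_differenceM (IHd).
by exists (Var i), One => v /=; lia.
Qed.

Lemma poly_eval_eq0 n m (W : {mpoly int[n + m]}) :
  exists P Q : expr (n + m), forall (a : n.-tuple nat) (x : m.-tuple nat),
    let z j := (nth 0 (a ++ x) j).+1 in
    poly_eval W a x = 0 <-> eval z P = eval z Q.
Proof.
have [P [Q WE]] := shifted_difference_meval W.
exists P, Q => a x z; rewrite /poly_eval.
rewrite (@meval_eq _ _ _ (fun i => (nth 0%N (a ++ x) i)%:Z)); last first.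
  by move=> i; rewrite (tnth_nth 0%N).
rewrite (WE (nth 0%N (a ++ x))) -/z; split=> [/eqP|->]; last by rewrite subrr.
by rewrite subr_eq0 => /eqP[].
Qed.
End PolynomialEquations.

(** * Compiling terms into elementary equations *)

(** The equations of B_n with indices in nat, so that a list of them keeps its
type while variables are added. *)
Inductive constraint : Type :=
  | ProdC of nat & nat & nat
  | NextC of nat & nat.

Definition holds (x : nat -> nat) (c : constraint) : Prop :=
  match c with
  | ProdC i j k => x i * x j = x k
  | NextC i k => x i + 1 = x k
  end.

Definition bounded (N : nat) (c : constraint) : bool :=
  match c with
  | ProdC i j k => [&& i < N, j < N & k < N]
  | NextC i k => (i < N) && (k < N)
  end.

Fixpoint holds_all (x : nat -> nat) (L : seq constraint) : Prop :=
  if L is c :: L' then holds x c /\ holds_all x L' else True.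

Lemma holds_all_cat x L M :
  holds_all x (L ++ M) <-> holds_all x L /\ holds_all x M.
Proof. elim: L => /= [|c L IH]; tauto. Qed.

Lemma sub_bounded N M c : N <= M -> bounded N c -> bounded M c.
Proof. case: c => /= *; lia. Qed.

(** The default value of [nth] is 1 rather than 0 so that a positive tuple
becomes an assignment that is positive at every index. *)
Lemma system_of_constraints N (L : seq constraint) :
  all (bounded N) L ->
  exists S : {set equation N}, forall x : N.-tuple nat,
    (forall e, e \in S -> satisfies x e) <-> holds_all (nth 1 x) L.
Proof.
elim: L => [_|c L IH /= /andP[cN /IH[S SE]]].
  by exists set0 => x; split=> // _ e; rewrite inE.
have [e eE] : exists e : equation N, forall x : N.-tuple nat,
    satisfies x e <-> holds (nth 1 x) c.
  case: c cN => [i j k /and3P[iN jN kN]|i k /andP[iN kN]].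
    exists (MulEq (Ordinal iN) (Ordinal jN) (Ordinal kN)) => x /=.
    by rewrite !(tnth_nth 1).
  exists (SuccEq (Ordinal iN) (Ordinal kN)) => x /=.
  by rewrite !(tnth_nth 1).
exists (e |: S) => x; rewrite -eE -SE; split=> [sat|[sat_e sat] f].
  by split=> [|f fS]; apply: sat; rewrite !inE ?eqxx ?fS ?orbT.
by rewrite !inE => /predU1P[->|/sat].
Qed.

Section Compilation.
Variable q : nat.
Implicit Types (T : seq (expr q)) (e d f : expr q).

(** The offset [s] serves a block of new variables: their terms are still
evaluated at the inputs x_0, ..., x_{q-1} of the whole assignment. *)
Fixpoint agree s (x : nat -> nat) T : Prop :=
  if T is e :: T' then x s = eval x e /\ agree s.+1 x T' else True.

Lemma agree_cat s x T T' :
  agree s x (T ++ T') <-> agree s x T /\ agree (s + size T) x T'.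
Proof.
elim: T s => /= [|e T IH] s; first by rewrite addn0; tauto.
rewrite -addSnnS; have := IH s.+1; tauto.
Qed.

Lemma agreeP s x T :
  agree s x T <-> forall j, j < size T -> x (s + j) = eval x (nth One T j).
Proof.
elim: T s => [|e T IH] s; first by split.
split=> [[xs /IH xT] [|j] /= jT|xT].
- by rewrite addn0.
- by rewrite -addSnnS xT.
split; first by have := xT 0 isT; rewrite addn0.
by apply/IH=> j jT; rewrite addSnnS; apply: (xT j.+1).
Qed.

(** [T] names the variables of a system: variable j stands for the j-th term.
Each of these terms is a function of the inputs, hence a positive solution of
[L] is determined by its inputs, and these are arbitrary. *)
Definition defines (L : seq constraint) T : Prop :=
  all (bounded (size T)) L /\
  forall x, (forall i, 0 < x i) -> (holds_all x L <-> agree 0 x T).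

Definition listed T e : Prop := exists2 r, r < size T & nth One T r = e.

Lemma listed_cat T T' e : listed T e -> listed (T ++ T') e.
Proof.
by move=> [r rT re]; exists r; rewrite ?nth_cat ?rT // size_cat ltn_addr.
Qed.

Lemma agree_nth x T r : agree 0 x T -> r < size T -> x r = eval x (nth One T r).
Proof. by move/agreeP => xT /xT. Qed.

Lemma defines_cat L M T T' :
    defines L T -> all (bounded (size T + size T')) M ->
    (forall x, (forall i, 0 < x i) -> agree 0 x T ->
       (holds_all x M <-> agree (size T) x T')) ->
  defines (L ++ M) (T ++ T').
Proof.
move=> [LT LE] MT ME; split=> [|x x_gt0].
  rewrite all_cat size_cat MT andbT; apply: sub_all LT => c.
  exact: (sub_bounded (leq_addr _ _)).
rewrite holds_all_cat agree_cat LE // add0n.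
by split=> -[xT xM]; split=> //; apply/ME.
Qed.

(** Among positive integers, 1 is the only idempotent. *)
Lemma defines_one L T : defines L T ->
  exists M, defines M (T ++ [:: One]).
Proof.
move=> LT; exists (L ++ [:: ProdC (size T) (size T) (size T)]).
apply: defines_cat LT _ _ => /= [|x x_gt0 _]; first by lia.
have := x_gt0 (size T); split=> -[xx _]; split=> //; nia.
Qed.

Lemma defines_next L T e : defines L T -> listed T e ->
  exists M, defines M (T ++ [:: Next e]).
Proof.
move=> LT [r rT re]; exists (L ++ [:: NextC r (size T)]).
apply: defines_cat LT _ _ => /= [|x _ xT]; first by lia.
by rewrite (agree_nth xT rT) re addn1; split=> -[-> _].
Qed.

Lemma defines_mul L T d e : defines L T -> listed T d -> listed T e ->
  exists M, defines M (T ++ [:: Mul d e]).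
Proof.
move=> LT [r rT rd] [s sT se]; exists (L ++ [:: ProdC r s (size T)]).
apply: defines_cat LT _ _ => /= [|x _ xT]; first by lia.
by rewrite (agree_nth xT rT) (agree_nth xT sT) rd se; split=> -[-> _].
Qed.

(** After cancelling z^2 xy + 1 the identity says z^2 = z(x + y). *)
Lemma addition_identity x y z : 0 < z ->
  ((z * z) * (x * y + 1) + 1 = (z * x + 1) * (z * y + 1)) <-> z = x + y.
Proof.
move=> z_gt0; split=> [h|->]; last by ring.
have : z * z = z * (x + y) by nia.
by move/eqP; rewrite eqn_pmul2l // => /eqP.
Qed.

(** The sum z is a new variable not computed from earlier ones: the ten
equations compute both sides of the addition identity and then equate them,
which determines z.  Hence the sum enters together with the subterms of
the identity, all of them terms in the inputs. *)
Lemma defines_add L T d e : defines L T -> listed T d -> listed T e ->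
  exists M T', defines M (T ++ Add d e :: T').
Proof.
move=> LT [r rT rd] [t tT te].
pose s := size T; pose z := Add d e.
(* The last equation adds 1 to z^2(xy + 1), variable s + 9, and compares it
   with the product (zx + 1)(zy + 1), variable s + 5. *)
exists (L ++ [:: ProdC s r s.+1; NextC s.+1 s.+2; ProdC s t s.+3;
  NextC s.+3 s.+4; ProdC s.+2 s.+4 s.+4.+1; ProdC s s s.+4.+2;
  ProdC r t s.+4.+3; NextC s.+4.+3 s.+4.+4; ProdC s.+4.+2 s.+4.+4 s.+4.+4.+1;
  NextC s.+4.+4.+1 s.+4.+1]).
exists [:: Mul z d; Next (Mul z d); Mul z e; Next (Mul z e);
  Mul (Next (Mul z d)) (Next (Mul z e)); Mul z z; Mul d e; Next (Mul d e);
  Mul (Mul z z) (Next (Mul d e))].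
apply: defines_cat LT _ _ => [|x x_gt0 xT]; first by rewrite /= -/s; lia.
rewrite -/s /= (agree_nth xT rT) (agree_nth xT tT) rd te.
have [id1 id2] := addition_identity (eval x d) (eval x e) (x_gt0 s).
split.
  move=> [<-] [<-] [<-] [<-] [<-] [<-] [<-] [<-] [<-] [/id1 sE _].
  by rewrite -!sE !addn1.
move=> [sE] [->] [->] [->] [->] [->] [->] [->] [->] [-> _].
by have := id2 sE; rewrite -!sE !addn1; do !split=> //.
Qed.

Lemma compile e L T :
    (forall i, listed T (Var i)) -> defines L T ->
  exists M T', defines M (T ++ T') /\ listed (T ++ T') e.
Proof.
have last_listed T0 d T1 : listed (T0 ++ d :: T1) d.
  exists (size T0); first by rewrite size_cat /= addnS ltnS leq_addr.
  by rewrite nth_cat ltnn subnn.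
elim: e L T => [|i|d IHd|d IHd f IHf|d IHd f IHf] L T Tvar LT.
- by have [M MT] := defines_one LT; exists M, [:: One].
- by exists L, [::]; rewrite cats0.
- have [M [T1 [MT dT]]] := IHd _ _ Tvar LT.
  have [M' MT'] := defines_next MT dT.
  by exists M', (T1 ++ [:: Next d]); rewrite catA.
- have [M [T1 [MT dT]]] := IHd _ _ Tvar LT.
  have [i|M' [T2 [MT' fT]]] := IHf _ _ _ MT; first exact: listed_cat.
  have [M2 [T3 MT2]] := defines_add MT' (listed_cat _ dT) fT.
  by exists M2, (T1 ++ T2 ++ Add d f :: T3); rewrite !catA.
- have [M [T1 [MT dT]]] := IHd _ _ Tvar LT.
  have [i|M' [T2 [MT' fT]]] := IHf _ _ _ MT; first exact: listed_cat.
  have [M2 MT2] := defines_mul MT' (listed_cat _ dT) fT.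
  by exists M2, (T1 ++ T2 ++ [:: Mul d f]); rewrite !catA.
Qed.

(** The exact number of new variables matters: it makes the size of the final
system c + a with c independent of a. *)
Lemma compile_numeral a L T : defines L T -> listed T One ->
  exists M T', [/\ defines M (T ++ T'), size T' = a
                & listed (T ++ T') (numeral q a)].
Proof.
move=> LT oneT; elim: a => [|a [M [T' [MT sT' aT]]]].
  by exists L, [::]; rewrite cats0.
have [M' MT'] := defines_next MT aT.
exists M', (T' ++ [:: Next (numeral q a)]); rewrite size_cat sT' addn1 catA.
split=> //; exists (size (T ++ T')); first by rewrite [ltnRHS]size_cat /= addn1.
by rewrite nth_cat ltnn subnn.
Qed.

Definition inputs : seq (expr q) := [seq Var i | i <- enum 'I_q].

Lemma size_inputs : size inputs = q.
Proof. by rewrite size_map size_enum_ord. Qed.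

Lemma nth_inputs T (i : 'I_q) : nth One (inputs ++ T) i = Var i.
Proof.
rewrite nth_cat size_inputs ltn_ord (nth_map i) ?size_enum_ord //.
by rewrite nth_ord_enum.
Qed.

Lemma listed_inputs i : listed inputs (Var i).
Proof. by exists i; rewrite ?size_inputs // -(nth_inputs [::]) cats0. Qed.

Lemma defines_inputs : defines [::] inputs.
Proof.
split=> // x _; split=> // _; apply/agreeP=> j.
rewrite size_inputs => jq.
by rewrite -[inputs]cats0 (nth_inputs [::] (Ordinal jq)).
Qed.

End Compilation.

(** The terms 1, P and Q are compiled once, in c variables; only the chain of
successors that produces a + 1 depends on a.  Two products with the variable
for 1 then force x_0 = a + 1 and P = Q.  The list of terms starts with the
inputs, so that a solution can be built from its input values alone. *)
Lemma pinned_system q (P Q : expr q.+1) :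
  exists2 c, 0 < c & forall a, exists (S : {set equation (c + a)}) T,
    size (inputs q.+1 ++ T) = c + a /\
    forall x : (c + a).-tuple nat,
      let v := nth 1 x in
      positive_solution S x <->
      [/\ forall i, 0 < v i, agree 0 v (inputs q.+1 ++ T), v 0 = a.+1
        & eval v P = eval v Q].
Proof.
have vars T i := @listed_cat q.+1 _ T _ (listed_inputs i).
have vars0 i := @listed_inputs q.+1 i.
have [L1 [T1 [LT1 oneT]]] := compile One vars0 (@defines_inputs q.+1).
have [L2 [T2 [LT2 PT]]] := compile P (vars _) LT1.
have vars2 i : listed ((inputs q.+1 ++ T1) ++ T2) (Var i).
  by rewrite -catA; apply: vars.
have [L3 [T3 [LT3 QT]]] := compile Q vars2 LT2.
exists (size (((inputs q.+1 ++ T1) ++ T2) ++ T3)) => [|a].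
  by rewrite -!catA size_cat size_inputs.
have oneT3 := listed_cat T3 (listed_cat T2 oneT).
have [L4 [T4 [LT4 sT4 aT]]] := compile_numeral a LT3 oneT3.
have [o oN oE] := listed_cat T4 oneT3.
have [p pN pE] := listed_cat T4 (listed_cat T3 PT).
have [r rN rE] := listed_cat T4 QT.
have [n nN nE] := aT.
have TE : (((inputs q.+1 ++ T1) ++ T2) ++ T3) ++ T4 =
          inputs q.+1 ++ (T1 ++ T2 ++ T3 ++ T4) by rewrite -!catA.
(* Replacing c + a by the size of the whole list of terms makes the indices of
   the constraints bounded by the number of variables. *)
rewrite -sT4 -size_cat.
move: LT4 oN oE pN pE rN rE nN nE; rewrite TE.
set T := T1 ++ _ => -[LN LE] oN oE pN pE rN rE nN nE.
pose M := [:: ProdC o n 0; ProdC o p r].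
have [|S SE] := @system_of_constraints (size (inputs q.+1 ++ T)) (L4 ++ M).
  rewrite all_cat LN /= oN pN rN nN !andbT.
  by rewrite size_cat size_inputs.
exists S, T; split=> // x v.
have vE i : i < size (inputs q.+1 ++ T) -> agree 0 v (inputs q.+1 ++ T) ->
    v i = eval v (nth One (inputs q.+1 ++ T) i).
  by move=> iN vT; apply: agree_nth.
have pos : (forall i, 0 < tnth x i) <-> (forall i, 0 < v i).
  split=> h i; last by rewrite (tnth_nth 1); apply: h.
  rewrite /v; case: (ltnP i (size x)) => [|ix]; last by rewrite nth_default.
  by rewrite size_tuple => ix; have := h (Ordinal ix); rewrite (tnth_nth 1).
rewrite /positive_solution pos SE holds_all_cat.
split=> [[v_gt0 [/(LE _ v_gt0) vT /= [e1 [e2 _]]]]|[v_gt0 vT v0 PQ]].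
  move: e1 e2; rewrite -/v (vE o) // (vE p) // (vE r) // (vE n) //.
  by rewrite oE nE pE rE eval_numeral /= !mul1n sT4 => <- ->.
split=> //; split; first exact/LE.
rewrite /= -/v (vE o) // (vE p) // (vE r) // (vE n) //.
by rewrite oE nE pE rE eval_numeral /= !mul1n v0 sT4 PQ.
Qed.

(** * The bound on unique solutions *)

(** (C) applied to the system of [pinned_system]: its unique solution [z]
consists of the values of its terms at a + 1, y_1 + 1, ..., y_q + 1. *)
Lemma solution_bound : statement_C ->
  forall q (W : {mpoly int[1 + q]}), exists2 c, 0 < c &
  forall (a : 1.-tuple nat) (y : q.-tuple nat),
    unique (fun y' => poly_eval W a y' = 0%R) y ->
  forall i, tnth y i < g (2 * (c + thead a)).
Proof.
move=> C q W; have [P [Q WE]] := poly_eval_eq0 W.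
have [c c_gt0 sysE] := pinned_system P Q.
exists c => // a y [Wy y_uniq] i.
have [S [T [sT SE]]] := sysE (thead a).
set N := c + thead a in S sT SE *.
pose u j := (nth 0 (a ++ y) j).+1.
pose z : N.-tuple nat := Tuple (introT eqP (etrans (size_map (eval u) _) sT)).
have zE j : j < N -> nth 1 z j = eval u (nth One (inputs q.+1 ++ T) j).
  by move=> jN; rewrite (nth_map One) // sT.
have qN : q.+1 <= N by rewrite -sT size_cat size_inputs leq_addr.
have zu (j : 'I_q.+1) : nth 1 z j = u j.
  by rewrite zE ?nth_inputs //; apply: leq_trans qN.
have u0 : u 0 = (thead a).+1.
  by rewrite /u nth_cat size_tuple /= /thead (tnth_nth 0).
have N_gt0 : 0 < N by rewrite addn_gt0 c_gt0.
have z_sol : unique (positive_solution S) z.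
  split.
    apply/SE; split.
    - move=> j; case: (ltnP j N) => jN; first by rewrite zE // eval_gt0.
      by rewrite nth_default // size_tuple.
    - by apply/agreeP=> j; rewrite sT => jN; rewrite add0n zE // (eq_eval _ zu).
    - by rewrite -u0 (zu ord0).
    by rewrite !(eq_eval _ zu); apply/WE.
  move=> x /SE[x_gt0 xT x0 PQ].
  pose y' := [tuple (nth 1 x j.+1).-1 | j < q].
  have xu' (j : 'I_q.+1) : nth 1 x j = (nth 0 (a ++ y') j).+1.
    rewrite nth_cat size_tuple; case: j => -[|j] jq.
      by rewrite x0 /= /thead (tnth_nth 0).
    rewrite subn1 /= (nth_map (Ordinal (jq : j < q))) ?size_enum_ord //.
    by rewrite (nth_ord_enum _ (Ordinal (jq : j < q))) /= prednK.
  have yy' : y = y'.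
    by apply/y_uniq/WE; rewrite -!(eq_eval _ xu').
  have xu (j : 'I_q.+1) : nth 1 x j = u j by rewrite xu' /u yy'.
  apply/eq_from_tnth=> j; rewrite !(tnth_nth 1) zE //.
  by rewrite (agree_nth xT) ?sT // (eq_eval _ xu).
have iN : i.+1 < N by apply: leq_trans qN; rewrite ltnS.
have := C _ N_gt0 S z z_sol (Ordinal iN).
rewrite (tnth_nth 1) /= (zu (lift ord0 i)) /u nth_cat size_tuple /=.
by rewrite /bump /= subn1 (tnth_nth 0).
Qed.

(** * Recursive functions *)

(** Functions are defined on all sequences and constrained only on those of
size [n], which avoids casts between tuple types when arguments are dropped or
concatenated. *)
Definition recursive n (F : seq nat -> nat) : Prop :=
  exists f : recfun n, forall (v : n.-tuple nat) y, computes f v y <-> y = F v.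

Lemma eq_recursive n F G :
  (forall v, size v = n -> F v = G v) -> recursive n F -> recursive n G.
Proof.
by move=> FG [f fE]; exists f => v y; rewrite fE FG // size_tuple.
Qed.

Lemma recursive_nth n i : i < n -> recursive n (fun v => nth 0 v i).
Proof.
by move=> ip; exists (RProj (Ordinal ip)) => v y /=; rewrite (tnth_nth 0).
Qed.

Lemma recursive_comp n k F (H : nat -> seq nat -> nat) :
    recursive k F -> (forall i, i < k -> recursive n (H i)) ->
  recursive n (fun v => F [seq H i v | i <- iota 0 k]).
Proof.
move=> [f fE] HR.
have /fin_all_exists[h hE] (i : 'I_k) :
    exists h : recfun n,
      forall (v : n.-tuple nat) y, computes h v y <-> y = H i v.
  exact: HR.
exists (RComp f h) => v y /=.
pose w0 := [tuple H i v | i < k].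
have -> : [seq H i v | i <- iota 0 k] = w0.
  by rewrite /= -val_enum_ord -map_comp.
split=> [[w [wE]]|->].
  suff -> : w = w0 by move/fE.
  by apply/eq_from_tnth => i; rewrite tnth_mktuple; apply/hE/wE.
by exists w0; split=> [i|]; [apply/hE; rewrite tnth_mktuple | apply/fE].
Qed.

Lemma map_nth_drop n k v :
  size v = k + n -> [seq nth 0 v (k + i) | i <- iota 0 n] = drop k v.
Proof.
move=> sv; apply: (@eq_from_nth _ 0).
  by rewrite size_map size_iota size_drop sv addKn.
move=> i; rewrite size_map size_iota => ip.
by rewrite (nth_map 0) ?size_iota // nth_iota // nth_drop.
Qed.

Lemma recursive_drop n k F :
  recursive n F -> recursive (k + n) (fun v => F (drop k v)).
Proof.
move=> FR; have := @recursive_comp (k + n) n F (fun i v => nth 0 v (k + i)) FR.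
move/(_ (fun i (Hi : i < n) => recursive_nth (etrans (ltn_add2l k i n) Hi))).
by apply: eq_recursive => v sv; rewrite map_nth_drop.
Qed.

(** The argument lists that occur when a recursion carries parameters: a
computed head followed by a suffix of the given list. *)
Lemma recursive_cons n k F K :
    recursive n.+1 F -> recursive (k + n) K ->
  recursive (k + n) (fun v => F (K v :: drop k v)).
Proof.
move=> FR KR.
have := @recursive_comp (k + n) n.+1 F
  (fun i v => if i is j.+1 then nth 0 v (k + j) else K v) FR.
case=> [[_|i ip]//|f fE].
  by apply: recursive_nth; rewrite ltn_add2l.
exists f => v y; rewrite fE /= -[iota 1 n]/(iota (1 + 0) n) iotaDl -map_comp /=.
by rewrite map_nth_drop ?size_tuple.
Qed.

Lemma recursive_succ n A : recursive n A -> recursive n (fun v => (A v).+1).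
Proof.
move=> AR; have sR : recursive 1 (fun v => (head 0 v).+1).
  by exists RSucc => v y /=; rewrite /thead (tnth_nth 0) nth0.
exact: (recursive_comp sR (fun _ _ => AR)).
Qed.

Lemma recursive_const n c : recursive n (fun=> c).
Proof.
by elim: c => [|c IH]; [exists (RZero n) => v y | apply: recursive_succ].
Qed.

(** Primitive recursion with a computed depth [K v] and with the parameters [v]
available at each step: the form in which all later functions are obtained. *)
Lemma recursive_prec n K A S :
    recursive n K -> recursive n A -> recursive n.+2 S ->
  recursive n (fun v =>
    nat_rect (fun=> nat) (A v) (fun k z => S (k :: z :: v)) (K v)).
Proof.
move=> KR [fA AE] [fS SE].
pose R v k := nat_rect (fun=> nat) (A v) (fun k z => S (k :: z :: v)) k.
have RR : recursive n.+1 (fun v => R (behead v) (head 0 v)).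
  exists (RPrec fA fS) => v y /=; case/tupleP: v => k v.
  rewrite (_ : @behead_tuple n.+1 nat _ = v); last exact/val_inj.
  rewrite theadE /=; elim: k y => [|k IH] y /=; first exact: AE.
  split=> [[z [/IH -> /SE]]|->] //.
  by exists (R v k); split; [apply/IH | apply/SE].
have := recursive_cons (k := 0) RR KR.
by apply: eq_recursive => v _; rewrite /= drop0.
Qed.

Lemma recursive_drop2 n A : recursive n A ->
  recursive n.+2 (fun v => A (drop 2 v)).
Proof. exact: (@recursive_drop n 2). Qed.

Lemma recursive_add n A B : recursive n A -> recursive n B ->
  recursive n (fun v => A v + B v).
Proof.
move=> AR BR.
have := recursive_prec BR AR (recursive_succ (@recursive_nth n.+2 1 isT)).
apply: eq_recursive => v _.
by elim: (B v) => [|k /= ->]; rewrite ?addn0 ?addnS.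
Qed.

Lemma recursive_mul n A B : recursive n A -> recursive n B ->
  recursive n (fun v => A v * B v).
Proof.
move=> AR BR.
have := recursive_prec BR (recursive_const n 0)
  (recursive_add (@recursive_nth n.+2 1 isT) (recursive_drop2 AR)).
apply: eq_recursive => v _.
elim: (B v) => [|k /= ->]; rewrite ?muln0 //.
by rewrite drop0 mulnS addnC.
Qed.

Lemma recursive_pred n A : recursive n A -> recursive n (fun v => (A v).-1).
Proof.
move=> AR; have := recursive_prec AR (recursive_const n 0)
  (@recursive_nth n.+2 0 isT).
by apply: eq_recursive => v _; case: (A v).
Qed.

Lemma recursive_sub n A B : recursive n A -> recursive n B ->
  recursive n (fun v => A v - B v).
Proof.
move=> AR BR.
have := recursive_prec BR AR (recursive_pred (@recursive_nth n.+2 1 isT)).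
apply: eq_recursive => v _.
by elim: (B v) => [|k /= ->]; rewrite ?subn0 ?subnS.
Qed.

Lemma recursive_exp2 n A : recursive n A -> recursive n (fun v => 2 ^ A v).
Proof.
move=> AR; have := recursive_prec AR (recursive_const n 1)
  (recursive_mul (recursive_const _ 2) (@recursive_nth n.+2 1 isT)).
by apply: eq_recursive => v _; elim: (A v) => //= k ->; rewrite expnS.
Qed.

Lemma recursive_g n A : recursive n A -> recursive n (fun v => g (A v)).
Proof.
move=> AR; have := recursive_prec (recursive_pred AR) (recursive_const n 1)
  (recursive_exp2 (recursive_exp2 (@recursive_nth n.+2 1 isT))).
by apply: eq_recursive => v _; rewrite /g; elim: (A v).-1 => //= k ->.
Qed.

Lemma recursive_distance n A B : recursive n A -> recursive n B ->
  recursive n (fun v => (A v - B v) + (B v - A v)).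
Proof. by move=> AR BR; apply: recursive_add; apply: recursive_sub. Qed.

Lemma distance_eq0 a b : (a - b) + (b - a) = 0 <-> a = b.
Proof. lia. Qed.

Lemma recursive_eval n k (e : expr k) (X : nat -> seq nat -> nat) :
    (forall i : 'I_k, recursive n (X i)) ->
  recursive n (fun v => eval (fun i => X i v) e).
Proof.
move=> XR; elim: e => /= [|i|d IH|d IHd f IHf|d IHd f IHf].
- exact: recursive_const.
- exact: XR.
- exact: recursive_succ.
- exact: recursive_add.
- exact: recursive_mul.
Qed.

(** A zero below the bound is found one unknown at a time: the product of
F(y, s) over y < B vanishes exactly when one of its factors does, so it
replaces F by a function with one argument less. *)
Lemma recursive_bounded_search n m F B :
    recursive (m + n) F -> recursive n B ->
  exists2 G, recursive n G & forall v, size v = n ->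
    (G v = 0 <-> exists x : m.-tuple nat,
       (forall i, tnth x i < B v) /\ F (x ++ v) = 0).
Proof.
elim: m F => [|m IH] F FR BR.
  exists F => // v _; split=> [Fv|[x [_]]]; last by rewrite tuple0.
  by exists [tuple]; split=> // -[].
pose F1 s := nat_rect (fun=> nat) 1 (fun y z => z * F (y :: s)) (B (drop m s)).
have F1E x v : size x = m ->
    (F1 (x ++ v) = 0 <-> exists2 y, y < B v & F (y :: x ++ v) = 0).
  move=> sx; rewrite /F1 drop_size_cat //.
  elim: (B v) => [|b IHb] /=; first by split=> // -[].
  split=> [/eqP|[y]].
    rewrite muln_eq0 => /orP[/eqP/IHb[y yb Fy]|/eqP Fb]; last by exists b.
    by exists y; rewrite // ltnS ltnW.
  rewrite ltnS leq_eqVlt => /predU1P[-> ->|yb Fy]; first by rewrite muln0.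
  by have/IHb -> : exists2 y, y < b & F (y :: x ++ v) = 0 by exists y.
have F1R : recursive (m + n) F1.
  have stepR : recursive (m + n).+2 (fun s => F (nth 0 s 0 :: drop 2 s)).
    exact: (recursive_cons (k := 2) FR (@recursive_nth (m + n).+2 0 isT)).
  have := recursive_prec (recursive_drop m BR) (recursive_const (m + n) 1)
    (recursive_mul (@recursive_nth (m + n).+2 1 isT) stepR).
  apply: eq_recursive => v _; rewrite /F1.
  by elim: (B _) => //= k ->; rewrite drop0.
have [G GR GE] := IH F1 F1R BR.
exists G => // v sv; rewrite GE //; split=> [[x [xB]]|[x]].
  case/(F1E _ _ (size_tuple x)) => y yB Fy.
  exists [tuple of y :: x]; split=> // i.
  by case: (unliftP ord0 i) => [j|] ->; rewrite ?tnthS ?tnth0.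
case/tupleP: x => y x [xB Fy]; exists x; split=> [i|].
  by have := xB (lift ord0 i); rewrite tnthS.
apply/(F1E _ _ (size_tuple x)); exists y => //.
by have := xB ord0; rewrite tnth0.
Qed.

(** * Single-fold sets and the tower function *)

Lemma single_fold_computable : statement_C ->
  forall M : nat -> Prop, single_fold (natset1 M) -> computable (natset1 M).
Proof.
move=> C M [m [W [ME W_uniq]]].
have [c _ bound] := solution_bound C W.
have [P [Q WE]] := poly_eval_eq0 W.
(* The search puts the unknowns before the parameter a, whereas the polynomial
   takes a first; a is the last entry of the sequence. *)
pose X i (s : seq nat) := (nth 0 (last 0 s :: s) i).+1.
have XR (i : 'I_(1 + m)) : recursive (m + 1) (X i).
  apply: recursive_succ; case: i => -[|i] /= im.
    apply: eq_recursive (@recursive_nth (m + 1) m _); last by rewrite addn1.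
    by move=> v sv; rewrite -nth_last sv addn1.
  by apply: recursive_nth; rewrite addn1 ltnW.
have [G GR GE] := recursive_bounded_search
  (recursive_distance (recursive_eval P XR) (recursive_eval Q XR))
  (recursive_g (recursive_mul (recursive_const 1 2)
     (recursive_add (recursive_const 1 c) (@recursive_nth 1 0 isT)))).
have G0 (a : 1.-tuple nat) : G a = 0 <-> natset1 M a.
  rewrite GE ?size_tuple // ME.
  have WX (x : m.-tuple nat) : poly_eval W a x = 0%R <->
      eval (X^~ (x ++ a)) P = eval (X^~ (x ++ a)) Q.
    have XE (i : 'I_(1 + m)) : X i (x ++ a) = (nth 0 (a ++ x) i).+1.
      case/tupleP: a => a a0; rewrite tuple0 /X /= last_cat /=.
      case: i => -[|i] //= im; rewrite nth_cat size_tuple.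
      by rewrite (im : i < m).
    have XeE (e : expr (1 + m)) :
        eval (X^~ (x ++ a)) e = eval (fun j => (nth 0 (a ++ x) j).+1) e.
      exact: eq_eval.
    by rewrite WE !XeE.
  split=> [[x [_ /distance_eq0 PQ]]|[x Wx]]; first by exists x; apply/WX.
  exists x; split; last by apply/distance_eq0/WX.
  move=> i; have := bound a x _ i; rewrite /thead (tnth_nth 0 a); apply.
  by split=> // y; apply: W_uniq.
have [f fE] := recursive_sub (recursive_const 1 1) GR.
exists f => a; split=> Ma; apply/fE.
  by have /G0 -> := Ma.
have Ga : G a <> 0 by move/G0.
lia.
Qed.

(** The minimization has a dummy variable: it returns 0 on the graph and
diverges elsewhere. *)
Lemma tower_graph_re :
  recursively_enumerable
    (fun v : 2.-tuple nat => nth 0 v 1 = g (4 * nth 0 v 0)).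
Proof.
have [f fE] := recursive_distance (@recursive_nth 3 2 isT)
  (recursive_g (recursive_mul (recursive_const 3 4) (@recursive_nth 3 1 isT))).
exists (RMin f) => v /=; split=> [vE|[y [/fE]]].
  by exists 0; split=> //; apply/fE; rewrite /= vE subnn.
by move/esym/distance_eq0.
Qed.

Theorem theorem4 :
  (statement_C ->
     forall M : nat -> Prop, single_fold (natset1 M) -> computable (natset1 M))
  /\ ~ (statement_C /\ Matiyasevich_single_fold_conjecture).
Proof.
split; first exact: single_fold_computable.
case=> C /(_ 2 isT _ tower_graph_re)[m [W [ME W_uniq]]].
have [c c_gt0 bound] := @solution_bound C m.+1 W.
(* The arities 2 + m and 1 + m.+1 are convertible, so W is also a polynomial
   with the single parameter a and the unknowns b, x.  The value a = c is the
   one at which the bound g(2(c + a)) equals g(4a). *)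
pose a := [tuple c].
have evalE b (x : m.-tuple nat) :
    @poly_eval 1 m.+1 W a [tuple of b :: x] = poly_eval W [tuple c; b] x.
  by apply: meval_eq => i; rewrite !(tnth_nth 0).
have [x Wx] := (ME [tuple c; g (4 * c)]).1 erefl.
have := bound a [tuple of g (4 * c) :: x] _ ord0.
have -> : 2 * (c + thead a) = 4 * c by rewrite theadE; lia.
rewrite tnth0 ltnn => contra; apply: notF; apply: contra; split.
  by rewrite evalE.
move=> y; case/tupleP: y => b y; rewrite evalE => Wy.
have bE : b = g (4 * c) by have := (ME [tuple c; b]).2 (ex_intro _ y Wy).
move: Wy; rewrite bE => Wy.
by apply: val_inj; rewrite /= (W_uniq _ _ _ Wx Wy).
Qed.
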